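(* For real $\alpha,\nu$ and $x>0$ let $$B_\alpha(\nu,x)=\frac{x}{\delta_\alpha(\nu,x)+\sqrt{\delta_\alpha(\nu,x)^2+x^2}},\qquad \delta_\alpha(\nu,x)=\left(\nu-\tfrac12\right)+\frac{\lambda}{2\sqrt{\lambda^2+x^2}},\qquad \lambda=\nu+\tfrac12(\alpha-1).$$ Then for all $x>0$ $$\frac{I_{\nu}(x)}{I_{\nu-1}(x)}<B_{0}(\nu,x),\qquad \nu\ge 1/2,$$ $$\frac{I_{\nu}(x)}{I_{\nu-1}(x)}>B_{2}(\nu,x),\qquad \nu\ge 0.$$ These bounds are the best possible, in their range of validity, of the form $B_\alpha(\nu,x)$ for fixed $\alpha\in\mathbb{R}$. That is: if $\alpha\in\mathbb{R}$ is such that $B_\alpha(\nu,x)$ is an upper bound for $I_\nu(x)/I_{\nu-1}(x)$ for all $\nu\ge 1/2$ and $x>0$, then $B_0(\nu,x)\le B_\alpha(\nu,x)$ for all $\nu\ge1/2$, $x>0$; and if $\alpha\in\mathbb{R}$ is such that $B_\alpha(\nu,x)$ is a lower bound for $I_\nu(x)/I_{\nu-1}(x)$ for all $\nu\ge 0$ and $x>0$, then $B_\alpha(\nu,x)\le B_2(\nu,x)$ for all $\nu\ge 0$, $x>0$.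
   Context: $I_\nu$ denotes the modified Bessel function of the first kind of real order $\nu$; ''fixed $\alpha$'' means that $\alpha$ is a constant independent of $\nu$ and $x$. *)

(* Defs.v *)
From Stdlib Require Import Reals ZArith.
From Coquelicot Require Import Coquelicot.
Open Scope R_scope.

(* Euler's integral; it is the Gamma function for z > 0 only. *)
Definition Gamma (z : R) : R :=
  RInt_gen (fun t => Rpower t (z - 1) * exp (- t))
    (at_right 0) (Rbar_locally p_infty).

Fixpoint pochhammer (z : R) (n : nat) : R :=
  match n with
  | O => 1
  | S m => pochhammer z m * (z + INR m)
  end.

(* The entire function 1 / Gamma at an arbitrary real z, extended to z <= 0
   by Gamma (z + n) = z (z + 1) ... (z + n - 1) Gamma z.  The shift n is the
   least natural number with z + n > 0 (so n = 0 when z > 0); the value is 0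
   at z = 0, -1, -2, etc. *)
Definition rGamma (z : R) : R :=
  let n := Z.to_nat (up (- z)) in
  pochhammer z n / Gamma (z + INR n).

(* I_nu(x) = (x/2)^nu sum_k (x^2/4)^k / (k! Gamma(nu + k + 1)), meaningful for
   x > 0 and every real nu; with 1 / Gamma = 0 at the poles of Gamma this
   covers negative integer orders, e.g. I_{-1} = I_1. *)
Definition besselI (nu x : R) : R :=
  Rpower (x / 2) nu *
  PSeries (fun k => rGamma (nu + INR k + 1) / INR (fact k)) (x ^ 2 / 4).

Definition lambda (alpha nu : R) : R := nu + / 2 * (alpha - 1).

Definition delta (alpha nu x : R) : R :=
  (nu - / 2)
  + lambda alpha nu / (2 * sqrt (lambda alpha nu ^ 2 + x ^ 2)).

Definition B (alpha nu x : R) : R :=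
  x / (delta alpha nu x + sqrt (delta alpha nu x ^ 2 + x ^ 2)).

(* Main.v *)
(* Write I_nu(x) = (x/2)^nu f_nu(y) with y = x^2/4.  The entire functions f_nu
   satisfy f_nu' = f_(nu+1) and f_(nu-1) = nu f_nu + y f_(nu+1), and the ratio
   r = I_nu / I_(nu-1) equals (x/2) f_nu / f_(nu-1).  Since B_alpha is the
   positive root of x (1 - B^2) = 2 delta_alpha B, the sign of r - B_alpha is
   that of
     psi(y) = delta_alpha f_nu f_(nu-1) - f_(nu-1)^2 + y f_nu^2.
   For lambda > 0, psi vanishes at y = 0, and psi'(0) has the sign of
   lambda^2 - nu (nu + 1).  At a zero y > 0 of psi, the recurrences turn psi'(y)
   into an algebraic expression whose sign is constant for alpha = 0, nu > 1/2
   and for alpha = 2, nu >= 0; so psi never returns to 0.  For nu = 1/2,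
   f_(nu-1)^2 - y f_nu^2 is constant.

   As B_alpha decreases with alpha, sharpness means that no alpha > 0 gives an
   upper bound (it fails at nu = 1/2 as x -> oo) and no alpha < 2 a lower bound
   (it fails as x -> 0 once lambda^2 < nu (nu + 1), i.e. for large nu). *)

Require Import Defs.
From Stdlib Require Import Reals ZArith Lra Lia Psatz.
From Coquelicot Require Import Coquelicot.
Open Scope R_scope.

(** * Euler's integral *)

Lemma is_derive_Rpower (p t : R) (ht : 0 < t) :
  is_derive (fun t => Rpower t p) t (p * Rpower t (p - 1)).
Proof. now apply is_derive_Reals, derivable_pt_lim_power. Qed.

Lemma continuous_Gamma_integrand (p t : R) (ht : 0 < t) :
  continuous (fun t => Rpower t p * exp (- t)) t.
Proof.
  apply (ex_derive_continuous (K := R_AbsRing) (V := R_NormedModule)).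
  unfold Rpower; auto_derive; lra.
Qed.

Lemma ex_RInt_Gamma_integrand (p a b : R) (ha : 0 < a) (hb : 0 < b) :
  ex_RInt (fun t => Rpower t p * exp (- t)) a b.
Proof.
  apply (ex_RInt_continuous (V := R_CompleteNormedModule)).
  intros t [ht _]. apply continuous_Gamma_integrand.
  pose proof (Rmin_glb_lt a b 0 ha hb). lra.
Qed.

(** From [ln s <= s - 1] at [s = t / (2 * z)], multiplied by [z]; the remaining term [- z] is
    dropped. *)
Lemma Rpower_le_exp_half (z t : R) (hz : 0 < z) (ht : 0 < t) :
  Rpower t z <= Rpower (2 * z) z * exp (t / 2).
Proof.
  unfold Rpower. rewrite <- exp_plus.
  assert (h : ln (t / (2 * z)) <= t / (2 * z) - 1).
  { pose proof (exp_ineq1_le (ln (t / (2 * z)))) as h.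
    rewrite exp_ln in h; [lra | apply Rdiv_lt_0_compat; lra]. }
  rewrite ln_div in h by lra.
  apply (Rmult_le_compat_l z) in h; [| lra].
  replace (z * (t / (2 * z) - 1)) with (t / 2 - z) in h by (field; lra).
  destruct (Rle_lt_or_eq_dec (z * ln t) (z * ln (2 * z) + t / 2)) as [hlt | ->];
    [lra | now apply Rlt_le, exp_increasing | lra].
Qed.

(* With C e^(t/2) a bound for t^z, the integrand is at most
   (1+C)^2 t^(z-1) / (1 + t^z)^2, whose primitive -((1+C)^2/z) / (1 + t^z) is
   bounded on (0, oo). *)
Lemma RInt_Gamma_integrand_bounded (z : R) (hz : 0 < z) :
  exists M : R, forall a b, 0 < a <= b ->
    RInt (fun t => Rpower t (z - 1) * exp (- t)) a b <= M.
Proof.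
  set (C := Rpower (2 * z) z).
  assert (hC : 0 < C) by apply exp_pos.
  set (K := (1 + C) ^ 2).
  assert (hK : 0 < K) by (unfold K; nra).
  exists (K / z). intros a b [ha hab].
  set (h := fun t => - (K / z) / (1 + Rpower t z)).
  set (dh := fun t => K * Rpower t (z - 1) / (1 + Rpower t z) ^ 2).
  assert (hp : forall t p, 0 < Rpower t p) by (intros; apply exp_pos).
  assert (hI : is_RInt dh a b (minus (h b) (h a))).
  { apply (is_RInt_derive (V := R_CompleteNormedModule));
      rewrite Rmin_left, Rmax_right by lra; intros t ht.
    - unfold h, dh. pose proof (hp t z).
      evar_last.
      + apply (is_derive_div (fun _ => - (K / z)) (fun t => 1 + Rpower t z)).
        * apply @is_derive_const.
        * apply @is_derive_plus; [apply @is_derive_const |].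
          apply is_derive_Rpower; lra.
        * lra.
      + unfold zero, plus; simpl. field. lra.
    - apply (ex_derive_continuous (K := R_AbsRing) (V := R_NormedModule)).
      unfold dh. pose proof (hp t z) as hpt. unfold Rpower in hpt |- *.
      auto_derive. repeat split; try lra. simpl.
      apply Rgt_not_eq, Rlt_gt. apply Rmult_lt_0_compat; nra. }
  apply Rle_trans with (RInt dh a b).
  - apply RInt_le; [easy | apply ex_RInt_Gamma_integrand; lra
                   | eexists; exact hI |].
    intros t ht. unfold dh. pose proof (hp t z). pose proof (hp t (z - 1)).
    apply Rmult_le_reg_r with ((1 + Rpower t z) ^ 2); [nra |].
    replace (K * Rpower t (z - 1) / (1 + Rpower t z) ^ 2
             * (1 + Rpower t z) ^ 2) with (Rpower t (z - 1) * K)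
      by (field; lra).
    rewrite Rmult_assoc. apply Rmult_le_compat_l; [lra |].
    pose proof (Rpower_le_exp_half z t hz ltac:(lra)) as hb. fold C in hb.
    assert (h1 : 1 <= exp (t / 2)) by (pose proof (exp_ineq1_le (t / 2)); lra).
    (* Both [1] and [Rpower t z / C] are at most [exp (t / 2)], so [1 + t^z <= (1 + C) e^(t/2)]; the
       square of the right side times [e^(-t)] is exactly [K]. *)
    replace K with (exp (- t) * ((1 + C) * exp (t / 2)) ^ 2).
    + apply Rmult_le_compat_l; [apply Rlt_le, exp_pos |].
      apply pow_incr. nra.
    + replace (- t) with (- (t / 2 + t / 2)) by field.
      rewrite exp_Ropp, exp_plus. unfold K. field. lra.
  - rewrite (is_RInt_unique _ _ _ _ hI). unfold minus, plus, opp, h; simpl.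
    pose proof (hp a z). pose proof (hp b z).
    assert (0 < K / z) by (apply Rdiv_lt_0_compat; lra).
    assert (0 < / (1 + Rpower b z)) by (apply Rinv_0_lt_compat; lra).
    assert (/ (1 + Rpower a z) <= 1).
    { rewrite <- Rinv_1. apply Rinv_le_contravar; lra. }
    unfold Rdiv at 1 3. nra.
Qed.

(** The integral of a nonnegative function grows with the interval, so the improper integral is the
    supremum [l] of the proper ones. *)
Lemma RInt_gen_nonneg_bounded (f : R -> R) (M : R)
  (hI : forall a b, 0 < a -> 0 < b -> ex_RInt f a b)
  (hf : forall t, 0 < t -> 0 <= f t)
  (hM : forall a b, 0 < a <= b -> RInt f a b <= M) :
  exists l, is_RInt_gen f (at_right 0) (Rbar_locally p_infty) l /\
    forall a b, 0 < a <= b -> RInt f a b <= l.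
Proof.
  set (E := fun v => exists a b, 0 < a <= b /\ v = RInt f a b).
  destruct (completeness E) as [l [hub hlub]].
  - exists M. intros v (a & b & hab & ->). now apply hM.
  - exists (RInt f 1 1), 1, 1. split; [lra | easy].
  - assert (hl : forall a b, 0 < a <= b -> RInt f a b <= l)
      by (intros a b hab; apply hub; now exists a, b).
    exists l. split; [| exact hl].
    intros P [eps hP].
    assert (hex : exists a b, 0 < a <= b /\ l - eps < RInt f a b).
    { apply Classical_Prop.NNPP. intros hn.
      assert (l <= l - eps); [| destruct eps; simpl in *; lra].
      apply hlub. intros v (a & b & hab & ->).
      apply Rnot_lt_le. intros h. apply hn. now exists a, b. }
    destruct hex as (a0 & b0 & hab0 & h0).
    (* Every interval containing [[a0, b0]] has its integral between [l - eps] and [l]. *)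
    apply Filter_prod with (Q := fun a => 0 < a <= a0) (R := fun b => b0 <= b).
    + exists (mkposreal a0 (proj1 hab0)). intros a ha hpos.
      unfold ball in ha; simpl in ha. unfold AbsRing_ball, abs, minus, plus, opp in ha; simpl in ha.
      apply Rabs_def2 in ha. lra.
    + exists b0. intros; lra.
    + intros a b ha hb. exists (RInt f a b). simpl. split.
      * apply (RInt_correct (V := R_CompleteNormedModule)), hI; lra.
      * apply hP.
        assert (hs : RInt f a b = RInt f a a0 + RInt f a0 b0 + RInt f b0 b).
        { rewrite <- (RInt_Chasles f a a0 b), <- (RInt_Chasles f a0 b0 b)
            by (apply hI; lra).
          unfold plus; simpl. lra. }
        assert (0 <= RInt f a a0)
          by (apply RInt_ge_0; [lra | apply hI; lra | intros; apply hf; lra]).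
        assert (0 <= RInt f b0 b)
          by (apply RInt_ge_0; [lra | apply hI; lra | intros; apply hf; lra]).
        pose proof (hl a b ltac:(lra)).
        unfold ball; simpl. unfold AbsRing_ball, abs, minus, plus, opp; simpl.
        apply Rabs_def1; lra.
Qed.

(** [RInt_gen] is total, so [Gamma z] means Euler's integral only once convergence is known. *)
Lemma is_RInt_gen_Gamma (z : R) (hz : 0 < z) :
  is_RInt_gen (fun t => Rpower t (z - 1) * exp (- t))
    (at_right 0) (Rbar_locally p_infty) (Gamma z) /\ 0 < Gamma z.
Proof.
  destruct (RInt_Gamma_integrand_bounded z hz) as [M hM].
  destruct (RInt_gen_nonneg_bounded
              (fun t => Rpower t (z - 1) * exp (- t)) M) as (l & hl & hle).
  - intros. now apply ex_RInt_Gamma_integrand.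
  - intros. apply Rlt_le, Rmult_lt_0_compat; apply exp_pos.
  - exact hM.
  - unfold Gamma. rewrite (is_RInt_gen_unique _ _ hl).
    split; [exact hl |].
    apply Rlt_le_trans with (2 := hle 1 2 ltac:(lra)).
    apply RInt_gt_0; [lra | |].
    + intros. apply Rmult_lt_0_compat; apply exp_pos.
    + intros. apply continuous_Gamma_integrand. lra.
Qed.

Lemma Gamma_pos (z : R) (hz : 0 < z) : 0 < Gamma z.
Proof. now apply is_RInt_gen_Gamma. Qed.

(** Integration by parts: [G t = t^z e^(-t)] tends to 0 at both ends, so [G'], the difference of the
    two integrands, has integral 0. *)
Lemma Gamma_succ (z : R) (hz : 0 < z) : Gamma (z + 1) = z * Gamma z.
Proof.
  destruct (is_RInt_gen_Gamma z hz) as [h1 _].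
  destruct (is_RInt_gen_Gamma (z + 1) ltac:(lra)) as [h2 _].
  set (G := fun t => Rpower t z * exp (- t)).
  assert (dG : forall t, 0 < t -> is_derive G t
     (z * (Rpower t (z - 1) * exp (- t)) - Rpower t (z + 1 - 1) * exp (- t))).
  { intros t ht. unfold G.
    evar_last.
    - apply @is_derive_mult with (f := fun t => Rpower t z) (g := fun t => exp (- t)).
      + now apply is_derive_Rpower.
      + auto_derive; [easy | reflexivity].
      + intros; apply Rmult_comm.
    - unfold plus, mult; simpl. replace (z + 1 - 1) with z by ring. ring. }
  assert (hpos : filter_prod (at_right 0) (Rbar_locally p_infty)
     (fun ab => 0 < Rmin (fst ab) (snd ab))).
  { apply Filter_prod with (Q := fun a => 0 < a) (R := fun b => 0 < b).
    - exists (mkposreal 1 Rlt_0_1). intros; easy.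
    - now exists 0.
    - intros. simpl. now apply Rmin_glb_lt. }
  assert (hG : is_RInt_gen (Derive G) (at_right 0) (Rbar_locally p_infty)
                 (0 - 0)).
  { apply is_RInt_gen_Derive.
    - apply filter_imp with (2 := hpos). intros ab h t ht.
      eexists. apply dG. lra.
    - apply filter_imp with (2 := hpos). intros ab h t ht.
      apply continuous_ext_loc with
        (fun t => z * (Rpower t (z - 1) * exp (- t))
                  - Rpower t (z + 1 - 1) * exp (- t)).
      + assert (ht0 : 0 < t) by lra.
        exists (mkposreal t ht0). intros s hs. symmetry.
        apply is_derive_unique, dG.
        unfold ball in hs; simpl in hs. unfold AbsRing_ball, abs, minus, plus, opp in hs; simpl in hs.
        apply Rabs_def2 in hs. lra.
      + apply (ex_derive_continuous (K := R_AbsRing) (V := R_NormedModule)).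
        unfold Rpower. auto_derive. lra.
    (* Limit of [G] at [0+]: [z * ln t] tends to minus infinity, hence [t^z] to 0. *)
    - assert (hlz : filterlim (fun t => z * ln t) (at_right 0) (Rbar_locally m_infty)).
      { eapply filterlim_comp; [exact is_lim_ln_0 |].
        pose proof (is_lim_scal_l (fun t => t) z m_infty m_infty (is_lim_id _)) as h.
        unfold is_lim in h. simpl in h. destruct (Rle_dec 0 z); [| lra].
        destruct (Rle_lt_or_eq_dec 0 z r); [exact h | lra]. }
      apply filterlim_ext with (fun t => exp (z * ln t) * exp (- t)); [easy |].
      replace 0 with (0 * exp (- 0)) at 2 by ring.
      eapply filterlim_comp_2.
      + eapply filterlim_comp; [exact hlz | exact is_lim_exp_m].
      + refine (filterlim_filter_le_1 _ (_ : filter_le (at_right 0) (locally 0)) _).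
        * intros P hP. unfold at_right, within. eapply filter_imp; [| exact hP]. easy.
        * apply (ex_derive_continuous (K := R_AbsRing) (V := R_NormedModule) (fun t => exp (- t))).
          auto_derive. easy.
      + apply (filterlim_mult (K := R_AbsRing)).
    (* At infinity [G] is squeezed between 0 and a multiple of [e^(-t/2)]. *)
    - change (is_lim G p_infty 0).
      apply is_lim_le_le_loc with (f := fun _ => 0)
        (g := fun t => Rpower (2 * z) z * exp (- (t / 2))).
      + exists 0. intros t ht. unfold G. split.
        * apply Rlt_le, Rmult_lt_0_compat; apply exp_pos.
        * replace (exp (- (t / 2))) with (exp (t / 2) * exp (- t))
            by (rewrite <- exp_plus; f_equal; field).
          rewrite <- Rmult_assoc.
          apply Rmult_le_compat_r; [apply Rlt_le, exp_pos |].
          now apply Rpower_le_exp_half.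
      + apply is_lim_const.
      + replace (Finite 0) with (Rbar_mult (Rpower (2 * z) z) 0)
          by (simpl; f_equal; ring).
        apply is_lim_scal_l.
        apply is_lim_comp with m_infty.
        * exact is_lim_exp_m.
        * apply is_lim_ext with (fun t => (- / 2) * t); [intros; field |].
          pose proof (is_lim_scal_l (fun t => t) (- / 2) p_infty p_infty (is_lim_id _)) as h.
          simpl in h. destruct (Rle_dec 0 (- / 2)); [lra | exact h].
        * now exists 0. }
  pose proof (is_RInt_gen_minus _ _ _ _ (is_RInt_gen_scal _ z _ h1) h2) as h3.
  assert (h4 : is_RInt_gen (Derive G) (at_right 0) (Rbar_locally p_infty)
                 (minus (scal z (Gamma z)) (Gamma (z + 1)))).
  { eapply is_RInt_gen_ext; [| exact h3].
    apply filter_imp with (2 := hpos). intros ab h t ht.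
    unfold minus, scal, plus, opp; simpl. unfold mult; simpl.
    symmetry. apply is_derive_unique, dG. lra. }
  apply (is_RInt_gen_unique (V := R_CompleteNormedModule)) in h4.
  rewrite (is_RInt_gen_unique (V := R_CompleteNormedModule) _ _ hG) in h4.
  unfold minus, scal, plus, opp in h4; simpl in h4. unfold mult in h4; simpl in h4.
  lra.
Qed.

(** * The entire factor of the Bessel function *)

Lemma rGamma_of_pos (z : R) (hz : 0 < z) : rGamma z = / Gamma z.
Proof.
  unfold rGamma.
  assert (h : Z.to_nat (up (- z)) = 0%nat).
  { destruct (archimed (- z)) as [_ h].
    assert (IZR (up (- z)) < 1) as h1 by lra.
    apply lt_IZR in h1. lia. }
  rewrite h. simpl. rewrite Rplus_0_r. unfold Rdiv. ring.
Qed.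

Lemma rGamma_pos (z : R) (hz : 0 < z) : 0 < rGamma z.
Proof.
  rewrite rGamma_of_pos by easy. now apply Rinv_0_lt_compat, Gamma_pos.
Qed.

Lemma rGamma_0 : rGamma 0 = 0.
Proof.
  unfold rGamma.
  replace (up (- 0)) with 1%Z by (apply tech_up; lra).
  simpl. unfold Rdiv. ring.
Qed.

(** The case [z = 0], where both sides vanish, is what lets the order [nu - 1 = -1] enter the
    recurrence of the series. *)
Lemma rGamma_rec (z : R) (hz : 0 <= z) : rGamma z = z * rGamma (z + 1).
Proof.
  destruct (Rle_lt_or_eq_dec 0 z hz) as [h | <-].
  - rewrite !rGamma_of_pos by lra. rewrite Gamma_succ by easy.
    pose proof (Gamma_pos z h). field. lra.
  - rewrite rGamma_0. ring.
Qed.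

Definition bcoef (nu : R) (k : nat) : R := rGamma (nu + INR k + 1) / INR (fact k).

(* The f_nu of the header. *)
Definition bser (nu y : R) : R := PSeries (bcoef nu) y.

Lemma bcoef_pos (nu : R) (k : nat) (hnu : -1 < nu) : 0 < bcoef nu k.
Proof.
  apply Rdiv_lt_0_compat; [| apply INR_fact_lt_0].
  apply rGamma_pos. pose proof (pos_INR k). lra.
Qed.

Lemma bcoef_derive (nu : R) (k : nat) : PS_derive (bcoef nu) k = bcoef (nu + 1) k.
Proof.
  unfold PS_derive, bcoef.
  replace (nu + INR (S k) + 1) with (nu + 1 + INR k + 1)
    by (rewrite S_INR; ring).
  rewrite fact_simpl, mult_INR. field. split.
  - apply INR_fact_neq_0.
  - now apply not_0_INR.
Qed.

Lemma bcoef_succ (nu : R) (k : nat) (hnu : -1 < nu) :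
  bcoef nu (S k) / bcoef nu k = / ((nu + 1 + INR k) * (1 + INR k)).
Proof.
  pose proof (pos_INR k). pose proof (INR_fact_lt_0 k).
  pose proof (rGamma_pos (nu + INR k + 1 + 1) ltac:(lra)).
  unfold bcoef. rewrite (rGamma_rec (nu + INR k + 1)) by lra.
  rewrite fact_simpl, mult_INR, !S_INR.
  replace (nu + (INR k + 1) + 1) with (nu + INR k + 1 + 1) by ring.
  field. repeat split; lra.
Qed.

(** At [nu = -1] the constant coefficient is 0, which the ratio test forbids. The derived series has
    the same radius and only positive coefficients, so the test is applied to it. *)
Lemma bcoef_radius (nu : R) (hnu : -1 <= nu) : CV_radius (bcoef nu) = p_infty.
Proof.
  rewrite <- CV_radius_derive, (CV_radius_ext _ _ (bcoef_derive nu)).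
  apply CV_radius_infinite_DAlembert.
  - intros k. apply Rgt_not_eq, bcoef_pos. lra.
  - apply is_lim_seq_le_le_loc with (u := fun _ => 0) (w := fun k => / INR (S k)).
    + exists 0%nat. intros k _. rewrite bcoef_succ by lra.
      pose proof (pos_INR k).
      assert (h : 0 < / ((nu + 1 + 1 + INR k) * (1 + INR k))).
      { apply Rinv_0_lt_compat, Rmult_lt_0_compat; lra. }
      rewrite Rabs_pos_eq by lra. split; [lra |].
      rewrite S_INR. apply Rinv_le_contravar; nra.
    + apply is_lim_seq_const.
    + apply (is_lim_seq_incr_1 (fun k => / INR k)).
      replace (Finite 0) with (Rbar_inv p_infty) by easy.
      apply is_lim_seq_inv; [apply is_lim_seq_INR | easy].
Qed.

Lemma ex_bser (nu y : R) (hnu : -1 <= nu) : ex_pseries (bcoef nu) y.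
Proof. apply CV_radius_inside. now rewrite bcoef_radius. Qed.

Lemma is_derive_bser (nu y : R) (hnu : -1 <= nu) :
  is_derive (bser nu) y (bser (nu + 1) y).
Proof.
  unfold bser. rewrite <- (PSeries_ext _ _ y (bcoef_derive nu)).
  apply is_derive_PSeries. now rewrite bcoef_radius.
Qed.

Lemma bser_rec (nu y : R) (hnu : 0 <= nu) :
  bser (nu - 1) y = nu * bser nu y + y * bser (nu + 1) y.
Proof.
  unfold bser. rewrite <- PSeries_scal, <- PSeries_incr_1, <- PSeries_plus.
  - apply PSeries_ext. intros k.
    unfold PS_plus, PS_scal, PS_incr_1, bcoef, plus, scal, zero; simpl.
    unfold mult; simpl.
    replace (nu - 1 + INR k + 1) with (nu + INR k) by ring.
    pose proof (pos_INR k).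
    rewrite (rGamma_rec (nu + INR k)) by lra.
    destruct k as [| k].
    + simpl. field.
    + replace (nu + 1 + INR k + 1) with (nu + INR (S k) + 1)
        by (rewrite S_INR; ring).
      rewrite fact_simpl, mult_INR. field. split.
      * apply INR_fact_neq_0.
      * now apply not_0_INR.
  - apply ex_pseries_scal; [apply Rmult_comm |]. apply ex_bser. lra.
  - apply ex_pseries_incr_1. apply ex_bser. lra.
Qed.

Lemma bser_0_le (nu y : R) (hnu : -1 < nu) (hy : 0 <= y) : bser nu 0 <= bser nu y.
Proof.
  unfold bser. rewrite PSeries_0, PSeries_decr_1 by (apply ex_bser; lra).
  enough (0 <= PSeries (PS_decr_1 (bcoef nu)) y) by nra.
  unfold PSeries. set (u := fun k => PS_decr_1 (bcoef nu) k * y ^ k).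
  rewrite <- (Rmult_0_l (Series u)), <- Series_scal_l.
  apply Series_le.
  - intros k. rewrite Rmult_0_l. split; [lra |]. apply Rmult_le_pos.
    + apply Rlt_le, bcoef_pos; lra.
    + now apply pow_le.
  - apply ex_pseries_R. apply CV_radius_inside.
    rewrite CV_radius_decr_1, bcoef_radius by lra. easy.
Qed.

Lemma bser_pos_at_0 (nu : R) (hnu : -1 < nu) : 0 < bser nu 0.
Proof. unfold bser. rewrite PSeries_0. now apply bcoef_pos. Qed.

Lemma bser_pos (nu y : R) (hnu : -1 < nu) (hy : 0 <= y) : 0 < bser nu y.
Proof.
  apply Rlt_le_trans with (2 := bser_0_le nu y hnu hy). now apply bser_pos_at_0.
Qed.

(** The order may be [-1], where the series vanishes at 0; for [y > 0] the recurrence supplies the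
    positive term [y * bser (nu + 1) y]. *)
Lemma bser_pred_pos (nu y : R) (hnu : 0 <= nu) (hy : 0 < y) : 0 < bser (nu - 1) y.
Proof.
  rewrite bser_rec by easy.
  pose proof (bser_pos nu y ltac:(lra) ltac:(lra)).
  pose proof (bser_pos (nu + 1) y ltac:(lra) ltac:(lra)). nra.
Qed.

Lemma besselI_ratio (nu x : R) (hnu : 0 <= nu) (hx : 0 < x) :
  besselI nu x / besselI (nu - 1) x
  = (x / 2) * bser nu (x ^ 2 / 4) / bser (nu - 1) (x ^ 2 / 4).
Proof.
  change (besselI nu x) with (Rpower (x / 2) nu * bser nu (x ^ 2 / 4)).
  change (besselI (nu - 1) x)
    with (Rpower (x / 2) (nu - 1) * bser (nu - 1) (x ^ 2 / 4)).
  pose proof (bser_pred_pos nu (x ^ 2 / 4) hnu ltac:(nra)).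
  replace nu with (nu - 1 + 1) at 1 by ring.
  rewrite Rpower_plus, Rpower_1 by lra.
  assert (0 < Rpower (x / 2) (nu - 1)) by apply exp_pos.
  field. lra.
Qed.

(** * Comparison *)

Lemma is_derive_pos_local (f : R -> R) (c l : R) (hf : is_derive f c l) (hl : 0 < l) :
  exists e, 0 < e /\ forall h, 0 < h < e -> f (c - h) < f c < f (c + h).
Proof.
  apply is_derive_Reals in hf. destruct (hf l hl) as [e he].
  exists e. split; [apply cond_pos |]. intros h hh.
  assert (h1 := he h ltac:(lra) ltac:(rewrite Rabs_pos_eq; lra)).
  assert (h2 := he (- h) ltac:(lra) ltac:(rewrite Rabs_Ropp, Rabs_pos_eq; lra)).
  apply Rabs_def2 in h1, h2.
  assert (0 < (f (c + h) - f c) / h) as h3 by lra.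
  assert (0 < (f (c + - h) - f c) / - h) as h4 by lra.
  apply (Rmult_lt_compat_r h) in h3; [| lra].
  apply (Rmult_lt_compat_r h) in h4; [| lra].
  replace ((f (c + h) - f c) / h * h) with (f (c + h) - f c) in h3 by (field; lra).
  replace ((f (c + - h) - f c) / - h * h) with (f c - f (c - h)) in h4
    by (unfold Rminus; field; lra).
  lra.
Qed.

(** If [f b < 0], let [c] be the supremum of the points of [[0, b]] where [f >= 0]. Continuity
    excludes both signs of [f c], and at a zero the positive derivative makes [f] positive just to
    the right of [c]. *)
Lemma positive_of_increasing_zeros (f df : R -> R)
  (hf : forall y, 0 <= y -> is_derive f y (df y)) (h0 : 0 <= f 0)
  (hz : forall y, 0 <= y -> f y = 0 -> 0 < df y) (y : R) (hy : 0 < y) : 0 < f y.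
Proof.
  (* If [f] only vanishes at [y], it is negative just to the left, which gives [b]. *)
  apply Rnot_le_lt. intros hneg.
  assert (hb : exists b, 0 < b /\ f b < 0).
  { destruct (Rle_lt_or_eq_dec _ _ hneg) as [h | h]; [now exists y |].
    destruct (is_derive_pos_local f y _ (hf y ltac:(lra)) (hz y ltac:(lra) h))
      as (e & he & hloc).
    exists (y - Rmin (e / 2) (y / 2)).
    pose proof (Rmin_glb_lt (e / 2) (y / 2) 0 ltac:(lra) ltac:(lra)).
    pose proof (Rmin_l (e / 2) (y / 2)). pose proof (Rmin_r (e / 2) (y / 2)).
    split; [lra |]. rewrite <- h. apply hloc. lra. }
  destruct hb as (b & hb0 & hb).
  destruct (completeness (fun t => 0 <= t <= b /\ 0 <= f t)) as [c [hub hlub]].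
  { exists b. intros t ht. apply ht. }
  { exists 0. lra. }
  unfold is_upper_bound in hub, hlub. cbv beta in hub, hlub.
  assert (hc0 : 0 <= c) by (apply hub; lra).
  assert (hcb : c <= b) by (apply hlub; intros t ht; apply ht).
  assert (hcont : continuity_pt f c).
  { apply continuity_pt_filterlim.
    apply (ex_derive_continuous (K := R_AbsRing) (V := R_NormedModule)).
    eexists. now apply hf. }
  destruct (Rtotal_order (f c) 0) as [hlt | [heq | hgt]].
  - destruct (hcont (- f c) ltac:(lra)) as (e & he & hloc).
    simpl in hloc. unfold R_dist, D_x, no_cond in hloc.
    assert (c <= c - e / 2); [| lra].
    apply hlub. intros t [ht hft]. apply Rnot_lt_le. intros hct.
    pose proof (hub t (conj ht hft)).
    destruct (Req_dec c t) as [<- | hne]; [lra |].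
    assert (h1 : Rabs (f t - f c) < - f c).
    { apply hloc. split; [now split | apply Rabs_def1; lra]. }
    apply Rabs_def2 in h1. lra.
  - destruct (is_derive_pos_local f c _ (hf c hc0) (hz c hc0 heq))
      as (e & he & hloc).
    assert (hcb' : c < b) by (destruct (Req_dec c b) as [-> |]; lra).
    pose proof (Rmin_glb_lt (e / 2) (b - c) 0 ltac:(lra) ltac:(lra)) as hh.
    pose proof (Rmin_l (e / 2) (b - c)) as hhe.
    pose proof (Rmin_r (e / 2) (b - c)) as hhb.
    set (h := Rmin (e / 2) (b - c)) in *.
    assert (c + h <= c); [| lra].
    apply hub. pose proof (hloc h ltac:(lra)). lra.
  - destruct (hcont (f c) ltac:(lra)) as (e & he & hloc).
    simpl in hloc. unfold R_dist, D_x, no_cond in hloc.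
    assert (hcb' : c < b) by (destruct (Req_dec c b) as [-> |]; lra).
    pose proof (Rmin_glb_lt (e / 2) (b - c) 0 ltac:(lra) ltac:(lra)) as hh.
    pose proof (Rmin_l (e / 2) (b - c)) as hhe.
    pose proof (Rmin_r (e / 2) (b - c)) as hhb.
    set (h := Rmin (e / 2) (b - c)) in *.
    assert (c + h <= c); [| lra].
    apply hub. split; [lra |].
    assert (h1 : Rabs (f (c + h) - f c) < f c).
    { apply hloc. split; [split; [easy | lra] | apply Rabs_def1; lra]. }
    apply Rabs_def2 in h1. lra.
Qed.

(** * The comparison function [psi] and its derivative at zeros *)

(* With [L = lambda alpha nu] and [y = x^2/4], the first factor is
   [delta alpha nu x]. *)
Definition psi (L nu y : R) : R :=
  (nu - / 2 + L / (2 * sqrt (L ^ 2 + 4 * y))) * (bser nu y * bser (nu - 1) y)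
  - bser (nu - 1) y ^ 2 + y * bser nu y ^ 2.

Definition dpsi (L nu y : R) : R :=
  - L / sqrt (L ^ 2 + 4 * y) ^ 3 * (bser nu y * bser (nu - 1) y)
  + (nu - / 2 + L / (2 * sqrt (L ^ 2 + 4 * y)))
    * (bser (nu + 1) y * bser (nu - 1) y + bser nu y ^ 2)
  - 2 * bser (nu - 1) y * bser nu y
  + bser nu y ^ 2 + 2 * y * bser nu y * bser (nu + 1) y.

Lemma Derive_bser (nu y : R) (hnu : -1 <= nu) :
  Derive (fun t => bser nu t) y = bser (nu + 1) y.
Proof. apply is_derive_unique. now apply is_derive_bser. Qed.

Lemma is_derive_psi (L nu y : R) (hL : 0 < L ^ 2 + 4 * y) (hnu : 0 <= nu) :
  is_derive (psi L nu) y (dpsi L nu y).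
Proof.
  unfold psi, dpsi.
  assert (0 < sqrt (L ^ 2 + 4 * y)) by now apply sqrt_lt_R0.
  auto_derive.
  - repeat split; try (eexists; apply is_derive_bser; lra).
    + simpl in hL. lra.
    + simpl in H. lra.
  - rewrite !Derive_bser by lra. replace (nu - 1 + 1) with nu by ring.
    replace (L * (L * 1) + 4 * y) with (L ^ 2 + 4 * y) by ring.
    field. lra.
Qed.

(** For [L > 0] the first factor of [psi] is [nu] at [y = 0], and the recurrence there reads
    [bser (nu - 1) 0 = nu * bser nu 0]. *)
Lemma psi_0 (L nu : R) (hL : 0 < L) (hnu : 0 <= nu) : psi L nu 0 = 0.
Proof.
  unfold psi. rewrite Rmult_0_r, Rplus_0_r, sqrt_pow2, bser_rec by lra.
  field. lra.
Qed.

Lemma dpsi_0 (L nu : R) (hL : 0 < L) (hnu : 0 <= nu) :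
  exists k, 0 < k /\ dpsi L nu 0 = k * (L ^ 2 - nu * (nu + 1)).
Proof.
  pose proof (bser_pos_at_0 nu ltac:(lra)) as hb.
  exists (bser nu 0 ^ 2 / ((nu + 1) * L ^ 2)). split.
  { apply Rdiv_lt_0_compat; [nra |]. apply Rmult_lt_0_compat; nra. }
  unfold dpsi. rewrite Rmult_0_r, Rplus_0_r, sqrt_pow2, (bser_rec nu) by lra.
  pose proof (bser_rec (nu + 1) 0 ltac:(lra)) as h.
  replace (nu + 1 - 1) with nu in h by ring.
  replace (bser nu 0) with ((nu + 1) * bser (nu + 1) 0) by lra.
  field. lra.
Qed.

(* With a = bser (nu-1) y and b = bser nu y, psi = 0 means d = a/b - y b/a, so
   that s = a/b + y b/a is the square root of d^2 + 4y; here 4y = w^2 - L^2. *)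
Lemma dpsi_at_zero_of_psi (L nu y : R) (hnu : 0 <= nu) (hy : 0 < y)
  (hpsi : psi L nu y = 0) :
  let w := sqrt (L ^ 2 + 4 * y) in
  let U := L / w in
  let d := nu - / 2 + U / 2 in
  exists s k, 0 < s /\ s ^ 2 = d ^ 2 + (w ^ 2 - L ^ 2) /\ 0 < k /\
    dpsi L nu y = k * (2 * s * U - (2 * d + U - U ^ 3)).
Proof.
  intros w U d.
  assert (hw0 : 0 < L ^ 2 + 4 * y) by nra.
  assert (hw : 0 < w) by now apply sqrt_lt_R0.
  assert (hw2 : w ^ 2 = L ^ 2 + 4 * y) by (apply pow2_sqrt; lra).
  pose proof (bser_pos nu y ltac:(lra) ltac:(lra)) as hb.
  pose proof (bser_pred_pos nu y hnu hy) as ha.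
  pose proof (bser_rec nu y hnu) as hrec.
  unfold psi in hpsi. unfold dpsi. fold w in hpsi |- *.
  set (a := bser (nu - 1) y) in *. set (b := bser nu y) in *.
  assert (hc : bser (nu + 1) y = (a - nu * b) / y) by (rewrite hrec; field; lra).
  rewrite hc. clear hc hrec.
  assert (hd : d = a / b - y * b / a).
  { apply Rmult_eq_reg_r with (a * b); [| nra].
    replace ((a / b - y * b / a) * (a * b)) with (a ^ 2 - y * b ^ 2)
      by (field; lra).
    unfold d, U. replace (L / w / 2) with (L / (2 * w)) by (field; lra). lra. }
  assert (hL : L = U * w) by (unfold U; field; lra).
  exists (a / b + y * b / a), (a * b / (4 * y)). repeat split.
  - apply Rplus_lt_0_compat; apply Rdiv_lt_0_compat; nra.
  - rewrite hw2, hd. field. lra.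
  - apply Rdiv_lt_0_compat; nra.
  - replace (nu - / 2 + L / (2 * w)) with d by (unfold d, U; field; lra).
    assert (hnu' : nu = d + / 2 - U / 2) by (unfold d; ring).
    rewrite hnu'.
    (* [U - U^3 = U (w^2 - L^2) / w^2 = 4 y L / w^3]. *)
    replace (- L / w ^ 3) with (- (U - U ^ 3) / (4 * y)).
    + rewrite hd. field. lra.
    + unfold U. replace (4 * y) with (w ^ 2 - L ^ 2) by lra. field. nra.
Qed.

(** With [mu = U w] the right side is [U (2w + 2 - U^2)]. After cancelling [U], the difference of
    the squares is [(1 - U^2)(8w + 4 - U^2) > 0]. *)
Lemma crossing_upper (mu w s : R) (hmu : 0 < mu) (hw : mu < w) (hs : 0 < s) :
  let U := mu / w in let d := mu + U / 2 in
  s ^ 2 = d ^ 2 + (w ^ 2 - mu ^ 2) -> 2 * s * U < 2 * d + U - U ^ 3.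
Proof.
  intros U d hs2.
  assert (hm : mu = U * w) by (unfold U; field; lra).
  assert (hU : 0 < U < 1).
  { split; [apply Rdiv_lt_0_compat; lra |].
    apply Rmult_lt_reg_r with w; [lra |]. lra. }
  clearbody U.
  enough (2 * s < 2 * w + 2 - U ^ 2) by (unfold d; nra).
  assert (hA : 0 < 2 * w + 2 - U ^ 2) by nra.
  apply Rnot_le_lt. intros hle.
  assert (hsq : (2 * w + 2 - U ^ 2) ^ 2 <= (2 * s) ^ 2) by (apply pow_incr; lra).
  replace ((2 * s) ^ 2) with (4 * w ^ 2 + 4 * w * U ^ 2 + U ^ 2) in hsq.
  - assert (0 < (1 - U ^ 2) * (8 * w + 4 - U ^ 2)) by (apply Rmult_lt_0_compat; nra).
    lra.
  - replace ((2 * s) ^ 2) with (4 * s ^ 2) by ring.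
    rewrite hs2. unfold d. rewrite hm at 1 2. field.
Qed.

(** The reverse inequality would survive squaring, as [2 * s * U > 0]; but the difference of the
    squares factors as in [hdiff], with every factor positive for [0 < U < 1] and [L >= 1/2]. *)
Lemma crossing_lower (L w s : R) (hL : / 2 <= L) (hw : L < w) (hs : 0 < s) :
  let U := L / w in let d := L - 1 + U / 2 in
  s ^ 2 = d ^ 2 + (w ^ 2 - L ^ 2) -> 2 * d + U - U ^ 3 < 2 * s * U.
Proof.
  intros U d hs2.
  assert (hm : L = U * w) by (unfold U; field; lra).
  assert (hU : 0 < U < 1).
  { split; [apply Rdiv_lt_0_compat; lra |].
    apply Rmult_lt_reg_r with w; [lra |]. lra. }
  clearbody U. apply Rnot_le_lt. intros hle.
  assert (hsq : (2 * s * U) ^ 2 <= (2 * d + U - U ^ 3) ^ 2)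
    by (apply pow_incr; nra).
  replace ((2 * s * U) ^ 2) with (4 * U ^ 2 * s ^ 2) in hsq by ring.
  rewrite hs2 in hsq.
  assert (hdiff : 4 * U ^ 2 * (d ^ 2 + (w ^ 2 - L ^ 2)) - (2 * d + U - U ^ 3) ^ 2
    = (1 - U) * (1 + U) * (8 * (L - / 2) * (1 - U) + U * (U ^ 3 - 4 * U + 4))).
  { unfold d. rewrite hm. field. }
  assert (0 < (1 - U) * (1 + U) * (8 * (L - / 2) * (1 - U) + U * (U ^ 3 - 4 * U + 4))).
  { apply Rmult_lt_0_compat; [nra |].
    assert (0 < U ^ 3 - 4 * U + 4) by nra. nra. }
  lra.
Qed.

Lemma lt_sqrt_sq_add (L y : R) (hL : 0 < L) (hy : 0 < y) :
  L < sqrt (L ^ 2 + 4 * y).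
Proof.
  rewrite <- (sqrt_pow2 L) at 1 by lra. apply sqrt_lt_1; nra.
Qed.

(** * The sign of [psi] for alpha = 0 and alpha = 2 *)

Lemma psi_upper (nu y : R) (hnu : / 2 < nu) (hy : 0 < y) : psi (nu - / 2) nu y < 0.
Proof.
  set (L := nu - / 2).
  assert (hL : 0 < L) by (unfold L; lra).
  enough (0 < - psi L nu y) by lra.
  apply positive_of_increasing_zeros
    with (f := fun t => - psi L nu t) (df := fun t => - dpsi L nu t); [| | | easy].
  - intros t ht. apply @is_derive_opp with (f := psi L nu).
    apply is_derive_psi; nra.
  - rewrite psi_0; lra.
  - intros t ht hz. destruct (Rle_lt_or_eq_dec 0 t ht) as [ht' | <-].
    + destruct (dpsi_at_zero_of_psi L nu t) as (s & k & hs & hs2 & hk & ->);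
        try lra.
      pose proof (crossing_upper L (sqrt (L ^ 2 + 4 * t)) s hL
        (lt_sqrt_sq_add L t hL ht') hs hs2). simpl in H |- *. fold L.
      nra.
    (* The zero at the origin is treated apart, since the formula at a crossing divides by [y]. *)
    + destruct (dpsi_0 L nu) as (k & hk & ->); try lra.
      assert (L ^ 2 < nu * (nu + 1)) by (unfold L; nra). nra.
Qed.

Lemma psi_lower (nu y : R) (hnu : 0 <= nu) (hy : 0 < y) : 0 < psi (nu + / 2) nu y.
Proof.
  set (L := nu + / 2).
  assert (hL : / 2 <= L) by (unfold L; lra).
  apply positive_of_increasing_zeros with (df := dpsi L nu); [| | | easy].
  - intros t ht. apply is_derive_psi; nra.
  - rewrite psi_0; lra.
  - intros t ht hz. destruct (Rle_lt_or_eq_dec 0 t ht) as [ht' | <-].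
    + destruct (dpsi_at_zero_of_psi L nu t) as (s & k & hs & hs2 & hk & ->);
        try lra.
      replace (nu - / 2) with (L - 1) in hs2 |- * by (unfold L; field).
      pose proof (crossing_lower L (sqrt (L ^ 2 + 4 * t)) s hL
        (lt_sqrt_sq_add L t ltac:(lra) ht') hs hs2). simpl in H |- *.
      nra.
    + destruct (dpsi_0 L nu) as (k & hk & ->); try lra.
      assert (nu * (nu + 1) < L ^ 2) by (unfold L; nra). nra.
Qed.

(** This is [cosh^2 - sinh^2 = 1] up to a constant factor; the derivative vanishes by the recurrence
    at order [1/2]. *)
Lemma bser_half_invariant (y : R) (hy : 0 < y) :
  bser (/ 2 - 1) y ^ 2 - y * bser (/ 2) y ^ 2 = bser (/ 2 - 1) 0 ^ 2.
Proof.
  set (f := fun t => bser (/ 2 - 1) t ^ 2 - t * bser (/ 2) t ^ 2).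
  assert (df : forall t, is_derive f t 0).
  { intros t. unfold f. auto_derive.
    - repeat split; eexists; apply is_derive_bser; lra.
    - rewrite !Derive_bser by lra.
      pose proof (bser_rec (/ 2) t ltac:(lra)) as h.
      replace (/ 2 - 1 + 1) with (/ 2) by ring. rewrite h. field. }
  destruct (MVT_gen f 0 y (fun _ => 0)) as (c & _ & hc).
  - intros; apply df.
  - intros t _. apply continuity_pt_filterlim.
    apply (ex_derive_continuous (K := R_AbsRing) (V := R_NormedModule)).
    eexists. apply df.
  - unfold f in hc. lra.
Qed.

(** * From the sign of [psi] to bounds on the Bessel ratio *)

Lemma delta_add_sqrt_pos (d x : R) (hx : 0 < x) : 0 < d + sqrt (d ^ 2 + x ^ 2).
Proof.
  assert (Rabs d < sqrt (d ^ 2 + x ^ 2)).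
  { rewrite <- sqrt_Rsqr_abs. apply sqrt_lt_1; unfold Rsqr; nra. }
  pose proof (Rcomplements.Rabs_maj2 d). lra.
Qed.

Lemma delta_psi (alpha nu x : R) (hnu : 0 <= nu) (hx : 0 < x) :
  let r := besselI nu x / besselI (nu - 1) x in
  0 < r /\ exists k, 0 < k /\
    2 * delta alpha nu x * r - x * (1 - r ^ 2) = k * psi (lambda alpha nu) nu (x ^ 2 / 4).
Proof.
  intros r. unfold r. rewrite besselI_ratio by easy.
  pose proof (bser_pos nu (x ^ 2 / 4) ltac:(lra) ltac:(nra)) as hb.
  pose proof (bser_pred_pos nu (x ^ 2 / 4) hnu ltac:(nra)) as ha.
  unfold psi, delta.
  replace (4 * (x ^ 2 / 4)) with (x ^ 2) by field.
  set (a := bser (nu - 1) (x ^ 2 / 4)) in *. set (b := bser nu (x ^ 2 / 4)) in *.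
  set (d := nu - / 2 + _).
  split.
  - apply Rdiv_lt_0_compat; nra.
  (* Substituting [r = (x/2) b/a] and clearing [a^2] leaves [psi] with the factor [x / a^2]. *)
  - exists (x / a ^ 2). split; [apply Rdiv_lt_0_compat; nra |].
    field. lra.
Qed.

(** Since [(S + d)(S - d) = x^2], the assumption [x <= r (S + d)] also gives [S - d <= r x].
    Subtracting [r (S - d) <= r^2 x] from the first yields [x (1 - r^2) <= 2 d r], a
    contradiction. *)
Lemma lt_quadratic_root (d x r : R) (hx : 0 < x) (hr : 0 < r)
  (h : 2 * d * r < x * (1 - r ^ 2)) : r < x / (d + sqrt (d ^ 2 + x ^ 2)).
Proof.
  pose proof (delta_add_sqrt_pos d x hx) as hpos.
  assert (hS : sqrt (d ^ 2 + x ^ 2) ^ 2 = d ^ 2 + x ^ 2) by (apply pow2_sqrt; nra).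
  set (S := sqrt (d ^ 2 + x ^ 2)) in *.
  apply Rmult_lt_reg_r with (d + S); [easy |].
  replace (x / (d + S) * (d + S)) with x by (field; lra).
  apply Rnot_le_lt. intros hle.
  assert (0 < S - d) by nra.
  assert (S - d <= r * x).
  { apply Rmult_le_reg_l with x; [easy |].
    replace (x * (r * x)) with (r * (S + d) * (S - d)) by nra. nra. }
  nra.
Qed.

Lemma quadratic_root_lt (d x r : R) (hx : 0 < x) (hr : 0 < r)
  (h : x * (1 - r ^ 2) < 2 * d * r) : x / (d + sqrt (d ^ 2 + x ^ 2)) < r.
Proof.
  pose proof (delta_add_sqrt_pos d x hx) as hpos.
  assert (hS : sqrt (d ^ 2 + x ^ 2) ^ 2 = d ^ 2 + x ^ 2) by (apply pow2_sqrt; nra).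
  set (S := sqrt (d ^ 2 + x ^ 2)) in *.
  apply Rmult_lt_reg_r with (d + S); [easy |].
  replace (x / (d + S) * (d + S)) with x by (field; lra).
  apply Rnot_le_lt. intros hle.
  assert (0 < S - d) by nra.
  assert (r * x <= S - d).
  { apply Rmult_le_reg_l with x; [easy |].
    replace (x * (r * x)) with (r * (S + d) * (S - d)) by nra. nra. }
  nra.
Qed.

Lemma ratio_lt_B (alpha nu x : R) (hnu : 0 <= nu) (hx : 0 < x)
  (h : psi (lambda alpha nu) nu (x ^ 2 / 4) < 0) :
  besselI nu x / besselI (nu - 1) x < B alpha nu x.
Proof.
  destruct (delta_psi alpha nu x hnu hx) as (hr & k & hk & heq).
  apply lt_quadratic_root; [easy | easy | nra].
Qed.

Lemma B_lt_ratio (alpha nu x : R) (hnu : 0 <= nu) (hx : 0 < x)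
  (h : 0 < psi (lambda alpha nu) nu (x ^ 2 / 4)) :
  B alpha nu x < besselI nu x / besselI (nu - 1) x.
Proof.
  destruct (delta_psi alpha nu x hnu hx) as (hr & k & hk & heq).
  apply quadratic_root_lt; [easy | easy | nra].
Qed.

(** * Monotonicity in alpha and sharpness *)

Lemma div_sqrt_le_nonneg (l m x : R) (hx : 0 < x) (hl : 0 <= l) (hlm : l <= m) :
  l / sqrt (l ^ 2 + x ^ 2) <= m / sqrt (m ^ 2 + x ^ 2).
Proof.
  assert (hp : 0 < sqrt (l ^ 2 + x ^ 2)) by (apply sqrt_lt_R0; nra).
  assert (hq : 0 < sqrt (m ^ 2 + x ^ 2)) by (apply sqrt_lt_R0; nra).
  assert (hp2 : sqrt (l ^ 2 + x ^ 2) ^ 2 = l ^ 2 + x ^ 2) by (apply pow2_sqrt; nra).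
  assert (hq2 : sqrt (m ^ 2 + x ^ 2) ^ 2 = m ^ 2 + x ^ 2) by (apply pow2_sqrt; nra).
  set (p := sqrt (l ^ 2 + x ^ 2)) in *. set (q := sqrt (m ^ 2 + x ^ 2)) in *.
  apply Rmult_le_reg_r with (p * q); [nra |].
  replace (l / p * (p * q)) with (l * q) by (field; lra).
  replace (m / q * (p * q)) with (m * p) by (field; lra).
  apply Rsqr_incr_0_var; [| nra]. rewrite !Rsqr_pow2, !Rpow_mult_distr, hp2, hq2.
  assert (l ^ 2 <= m ^ 2) by (apply pow_incr; lra). nra.
Qed.

Lemma div_sqrt_le (l m x : R) (hx : 0 < x) (hlm : l <= m) :
  l / sqrt (l ^ 2 + x ^ 2) <= m / sqrt (m ^ 2 + x ^ 2).
Proof.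
  destruct (Rle_lt_dec 0 l) as [hl | hl]; [now apply div_sqrt_le_nonneg |].
  assert (hp : 0 < sqrt (l ^ 2 + x ^ 2)) by (apply sqrt_lt_R0; nra).
  assert (hq : 0 < sqrt (m ^ 2 + x ^ 2)) by (apply sqrt_lt_R0; nra).
  destruct (Rle_lt_dec 0 m) as [hm | hm].
  - apply Rle_trans with 0; unfold Rdiv.
    + pose proof (Rinv_0_lt_compat _ hp). nra.
    + pose proof (Rinv_0_lt_compat _ hq). nra.
  - pose proof (div_sqrt_le_nonneg (- m) (- l) x hx ltac:(lra) ltac:(lra)) as h.
    replace ((- m) ^ 2) with (m ^ 2) in h by ring.
    replace ((- l) ^ 2) with (l ^ 2) in h by ring.
    unfold Rdiv in *. lra.
Qed.

(** [delta] increases with alpha through [lambda], and [t + sqrt (t^2 + x^2)] increases with [t]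
    because the square root is 1-Lipschitz in [t]. *)
Lemma B_antitone (alpha beta nu x : R) (hx : 0 < x) (hab : alpha <= beta) :
  B beta nu x <= B alpha nu x.
Proof.
  assert (hd : delta alpha nu x <= delta beta nu x).
  { pose proof (div_sqrt_le (lambda alpha nu) (lambda beta nu) x hx
                  ltac:(unfold lambda; lra)) as h.
    unfold delta, Rdiv in *. rewrite !Rinv_mult. lra. }
  unfold B. set (c := delta alpha nu x) in *. set (d := delta beta nu x) in *.
  pose proof (delta_add_sqrt_pos c x hx). pose proof (delta_add_sqrt_pos d x hx).
  apply Rmult_le_compat_l; [lra |]. apply Rinv_le_contravar; [easy |].
  enough (sqrt (c ^ 2 + x ^ 2) <= sqrt (d ^ 2 + x ^ 2) + (d - c)) by lra.
  pose proof (sqrt_pos (d ^ 2 + x ^ 2)).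
  assert (hS : sqrt (d ^ 2 + x ^ 2) ^ 2 = d ^ 2 + x ^ 2) by (apply pow2_sqrt; nra).
  set (S := sqrt (d ^ 2 + x ^ 2)) in *.
  rewrite <- (sqrt_pow2 (S + (d - c))) by lra.
  apply sqrt_le_1; nra.
Qed.

(** At order [1/2] the invariant [D] absorbs the last two terms of [psi]. The remaining product of
    series grows at least like [K y], the square root only like [sqrt y]. *)
Lemma psi_half_pos_at_large (L : R) (hL : 0 < L) :
  exists y, 0 < y /\ 0 < psi L (/ 2) y.
Proof.
  pose proof (bser_pos_at_0 (/ 2) ltac:(lra)) as hb.
  pose proof (bser_pos_at_0 (/ 2 + 1) ltac:(lra)) as hc.
  set (K := bser (/ 2) 0 * bser (/ 2 + 1) 0).
  assert (hK : 0 < K) by (unfold K; nra).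
  set (D := bser (/ 2 - 1) 0 ^ 2).
  assert (hD : 0 <= D) by apply pow2_ge_0.
  (* Chosen so that, with [y = t^2] and [w <= (L + 2) t], [L K t^2] exceeds [2 D w]. *)
  set (t := 1 + 2 * D * (L + 2) / (L * K)).
  assert (ht : 1 <= t).
  { unfold t. enough (0 <= 2 * D * (L + 2) / (L * K)) by lra.
    apply Rdiv_le_0_compat; nra. }
  assert (htK : 2 * D * (L + 2) < L * K * t).
  { unfold t. replace (L * K * (1 + 2 * D * (L + 2) / (L * K)))
      with (L * K + 2 * D * (L + 2)) by (field; lra).
    assert (0 < L * K) by nra. lra. }
  exists (t ^ 2). split; [nra |].
  assert (hpsi : psi L (/ 2) (t ^ 2) = L / (2 * sqrt (L ^ 2 + 4 * t ^ 2))
            * (bser (/ 2) (t ^ 2) * bser (/ 2 - 1) (t ^ 2)) - D).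
  { unfold psi, D. rewrite <- (bser_half_invariant (t ^ 2)) by nra. ring. }
  rewrite hpsi. clear hpsi.
  assert (hab : t ^ 2 * K <= bser (/ 2) (t ^ 2) * bser (/ 2 - 1) (t ^ 2)).
  { rewrite bser_rec by lra.
    pose proof (bser_0_le (/ 2) (t ^ 2) ltac:(lra) ltac:(nra)) as h1.
    pose proof (bser_0_le (/ 2 + 1) (t ^ 2) ltac:(lra) ltac:(nra)) as h2.
    set (p := bser (/ 2) (t ^ 2)) in *. set (q := bser (/ 2 + 1) (t ^ 2)) in *.
    assert (K <= p * q) by (unfold K; apply Rmult_le_compat; lra).
    nra. }
  assert (hw : 0 < sqrt (L ^ 2 + 4 * t ^ 2)) by (apply sqrt_lt_R0; nra).
  assert (hw' : sqrt (L ^ 2 + 4 * t ^ 2) <= (L + 2) * t).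
  { rewrite <- (sqrt_pow2 ((L + 2) * t)) by nra.
    apply sqrt_le_1_alt.
    assert (0 <= L ^ 2 * (t ^ 2 - 1)) by (apply Rmult_le_pos; nra).
    assert (0 <= L * t ^ 2) by (apply Rmult_le_pos; nra). nra. }
  set (w := sqrt (L ^ 2 + 4 * t ^ 2)) in *.
  set (P := bser (/ 2) (t ^ 2) * bser (/ 2 - 1) (t ^ 2)) in *.
  enough (D * (2 * w) < L * P).
  { apply Rmult_lt_reg_r with (2 * w); [lra |].
    replace ((L / (2 * w) * P - D) * (2 * w)) with (L * P - D * (2 * w))
      by (field; lra). lra. }
  apply Rle_lt_trans with (2 * D * (L + 2) * t); [nra |].
  apply Rlt_le_trans with (L * K * t * t); nra.
Qed.

Lemma psi_neg_near_0 (L nu : R) (hL : 0 < L) (hnu : 0 <= nu)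
  (h : L ^ 2 < nu * (nu + 1)) : exists y, 0 < y /\ psi L nu y < 0.
Proof.
  destruct (is_derive_pos_local (fun t => - psi L nu t) 0 (- dpsi L nu 0))
    as (e & he & hloc).
  - apply @is_derive_opp with (f := psi L nu). apply is_derive_psi; nra.
  - destruct (dpsi_0 L nu) as (k & hk & ->); nra.
  - exists (e / 2). split; [lra |].
    pose proof (hloc (e / 2) ltac:(lra)) as h1. rewrite Rplus_0_l in h1.
    rewrite psi_0 in h1 by lra. lra.
Qed.

Lemma exists_sq_div_4 (y : R) (hy : 0 < y) : exists x, 0 < x /\ x ^ 2 / 4 = y.
Proof.
  exists (2 * sqrt y). split.
  - pose proof (sqrt_lt_R0 y hy). lra.
  - rewrite Rpow_mult_distr, pow2_sqrt by lra. field.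
Qed.

Theorem theorem5 :
  (forall nu x : R, / 2 <= nu -> 0 < x ->
     besselI nu x / besselI (nu - 1) x < B 0 nu x) /\
  (forall nu x : R, 0 <= nu -> 0 < x ->
     besselI nu x / besselI (nu - 1) x > B 2 nu x) /\
  (forall alpha : R,
     (forall nu x : R, / 2 <= nu -> 0 < x ->
        besselI nu x / besselI (nu - 1) x <= B alpha nu x) ->
     forall nu x : R, / 2 <= nu -> 0 < x -> B 0 nu x <= B alpha nu x) /\
  (forall alpha : R,
     (forall nu x : R, 0 <= nu -> 0 < x ->
        B alpha nu x <= besselI nu x / besselI (nu - 1) x) ->
     forall nu x : R, 0 <= nu -> 0 < x -> B alpha nu x <= B 2 nu x).
Proof.
  repeat split.
  - intros nu x hnu hx. apply ratio_lt_B; [lra | easy |].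
    replace (lambda 0 nu) with (nu - / 2) by (unfold lambda; ring).
    destruct (Rle_lt_or_eq_dec _ _ hnu) as [h | <-].
    + apply psi_upper; nra.
    (* At [nu = 1/2] both [nu - 1/2] and [lambda] are 0, so [psi] is minus the invariant. *)
    + pose proof (bser_half_invariant (x ^ 2 / 4) ltac:(nra)) as h.
      pose proof (bser_pos_at_0 (/ 2 - 1) ltac:(lra)).
      unfold psi. rewrite Rminus_diag. unfold Rdiv at 1.
      rewrite Rmult_0_l, Rplus_0_r, Rmult_0_l. nra.
  - intros nu x hnu hx. apply B_lt_ratio; [lra | easy |].
    replace (lambda 2 nu) with (nu + / 2) by (unfold lambda; field).
    apply psi_lower; nra.
  (* It remains to exclude [alpha > 0]; at [nu = 1/2] this makes [lambda = alpha / 2] positive. *)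
  - intros alpha h nu x hnu hx. apply B_antitone; [easy |].
    apply Rnot_lt_le. intros ha.
    destruct (psi_half_pos_at_large (alpha / 2) ltac:(lra)) as (y & hy & hpsi).
    destruct (exists_sq_div_4 y hy) as (z & hz & <-).
    apply (Rle_not_lt _ _ (h (/ 2) z ltac:(lra) hz)).
    apply B_lt_ratio; [lra | easy |].
    replace (lambda alpha (/ 2)) with (alpha / 2) by (unfold lambda; field).
    easy.
  - intros alpha h nu x hnu hx. apply B_antitone; [easy |].
    apply Rnot_lt_le. intros ha.
    set (e := (2 - alpha) / 2).
    assert (he : 0 < e) by (unfold e; lra).
    (* As [lambda = nu + 1/2 - e], one has [lambda^2 - nu (nu + 1) = (1/2 - e)^2 - 2 e nu]. The
       order [nu = e + q] makes this negative and keeps [lambda = q + 1/2] positive. *)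
    set (q := (/ 2 - e) ^ 2 / e).
    assert (hq : 0 <= q) by (apply Rdiv_le_0_compat; [apply pow2_ge_0 | easy]).
    assert (hqe : q * e = (/ 2 - e) ^ 2) by (unfold q; field; lra).
    assert (hl : lambda alpha (e + q) = q + / 2)
      by (unfold lambda, e; field; lra).
    destruct (psi_neg_near_0 (q + / 2) (e + q)) as (y & hy & hpsi);
      [lra | lra | nra |].
    destruct (exists_sq_div_4 y hy) as (z & hz & <-).
    apply (Rle_not_lt _ _ (h (e + q) z ltac:(lra) hz)).
    apply ratio_lt_B; [lra | easy |]. now rewrite hl.
Qed.
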